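(* For every integer $n\ge 4$, the minimum number of edges of a connected $4^*$-dense graph on $n$ vertices is $$e(4,n)=\begin{cases}2n-2 & \text{if } n\equiv 1 \pmod 3,\\ 2n-1 & \text{otherwise.}\end{cases}$$
   Context: All graphs are finite and simple. For an edge $uv$ of a graph $G$, the edge multiplicity is $m_G(uv)=|N_G(u)\cap N_G(v)|$. For an integer $k\ge 2$, a graph $G$ is called $k$-dense if $G$ has no isolated vertices and every edge $uv$ of $G$ satisfies $m_G(uv)\ge k-2$. A graph is $k^*$-dense if it is $k$-dense but not $(k+1)$-dense. For positive integers $k,n$, $e(k,n)$ denotes the minimum number of edges of a connected graph on $n$ vertices that is $k^*$-dense. *)

(* Defs.v *)
From mathcomp Require Import all_boot.
Set Implicit Arguments.
Unset Strict Implicit.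
Unset Printing Implicit Defensive.

Record sgraph := SGraph {
  vertex :> finType;
  adj : rel vertex;
  adj_sym : symmetric adj;
  adj_irrefl : irreflexive adj }.

Definition edges (G : sgraph) : {set {set G}} :=
  [set [set p.1; p.2] | p : G * G & adj p.1 p.2].

Definition neighbors (G : sgraph) (u : G) : {set G} := [set v | adj u v].

Definition multiplicity (G : sgraph) (u v : G) : nat :=
  #|neighbors u :&: neighbors v|.

Definition connected (G : sgraph) : Prop :=
  forall u v : G, connect (@adj G) u v.

(* Meaningful for k >= 2, where the truncated k - 2 is the true difference. *)
Definition dense (k : nat) (G : sgraph) : Prop :=
  (forall u : G, neighbors u != set0) /\
  (forall u v : G, adj u v -> k - 2 <= multiplicity u v).

Definition star_dense (k : nat) (G : sgraph) : Prop :=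
  dense k G /\ ~ dense k.+1 G.

Definition admissible (k n : nat) (G : sgraph) : Prop :=
  [/\ #|G| = n, connected G & star_dense k G].

(* e(k,n) = m, as a relation: for some (k, n) there is no admissible graph,
   and then no m is related to (k, n). *)
Definition is_e (k n m : nat) : Prop :=
  (exists2 G : sgraph, admissible k n G & #|edges G| = m) /\
  (forall G : sgraph, admissible k n G -> m <= #|edges G|).

(* Main.v *)
(** Lower bound: grow a set S from a single vertex, keeping the number of edges
    inside S at least 2|S| - 2, by adding to S all neighbours outside S of some
    v in S.  Each added w has at least two common neighbours with v, each of
    which lies either in S or among the added vertices, so at least two edges
    per added vertex are gained, and strictly more if w has a second neighbour
    in S that is adjacent to v.  One can therefore always gain an extra edge,
    unless a K4 meeting S in a single vertex can be added, which brings exactly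
    3 vertices and 6 edges.  Hence without extra edge |S| = 1 mod 3 throughout.

    Upper bound: a tree of copies of K4 glued at cut vertices, to which a last
    K4 is glued along a vertex, an edge or a triangle according to n mod 3. *)

Require Import Defs.
From mathcomp Require Import all_boot zify.

Set Implicit Arguments.
Unset Strict Implicit.
Unset Printing Implicit Defensive.

(** * Counting edges through ordered adjacent pairs *)

Section Arcs.
Variable G : sgraph.
Implicit Types (u v w x y : G) (A B S W : {set G}).

(** Ordered pairs make the count additive in both arguments; [arcs S S] is twice the number of edges
    inside [S]. *)
Definition arcs A B : nat := \sum_(x in A) \sum_(y in B) adj x y.

Lemma sum_adj_card x B : \sum_(y in B) adj x y = #|neighbors x :&: B|.
Proof.
rewrite -sum1_card [RHS](eq_bigl (fun y => (y \in B) && adj x y)); last first.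
  by move=> y; rewrite !inE andbC.
by rewrite -big_mkcondr; apply: eq_bigr => y _; case: (adj x y).
Qed.

Lemma arcsC A B : arcs A B = arcs B A.
Proof.
rewrite /arcs exchange_big; apply: eq_bigr => y _; apply: eq_bigr => x _.
by rewrite adj_sym.
Qed.

Lemma arcsUl A B C : [disjoint A & B] -> arcs (A :|: B) C = arcs A C + arcs B C.
Proof.
by move=> dAB; rewrite /arcs -bigU //; apply: eq_bigl => x; rewrite !inE.
Qed.

Lemma arcs_setU A B : [disjoint A & B] ->
  arcs (A :|: B) (A :|: B) = arcs A A + 2 * arcs B A + arcs B B.
Proof.
move=> dAB; rewrite arcsUl // arcsC arcsUl // [arcs B (_ :|: _)]arcsC arcsUl //.
rewrite (arcsC A B); lia.
Qed.

(** The fibre of [ends] over an edge [[set a; b]] is the pair of orderings [(a, b)], [(b, a)],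
    distinct by irreflexivity. *)
Lemma card_arcs : arcs setT setT = 2 * #|edges G|.
Proof.
pose ends (p : G * G) := [set p.1; p.2].
have -> : arcs setT setT = \sum_(p : G * G | adj p.1 p.2) 1.
  rewrite /arcs pair_big /= [RHS]big_mkcond /=.
  by apply: eq_big => [p|p _]; [rewrite !in_setT | case: ifP].
rewrite (partition_big ends (fun e => e \in edges G)) /=; last first.
  by move=> p hp; apply: imset_f; rewrite inE.
rewrite mulnC -sum_nat_const; apply: eq_bigr => e /imsetP[[a b]]; rewrite inE /= => hab ->.
have nab : a != b by apply: contraTneq hab => ->; rewrite adj_irrefl.
rewrite sum1_card -(_ : #|[set (a, b); (b, a)]| = 2); last first.
  by rewrite cards2 xpair_eqE negb_and nab.
apply: eq_card => -[c d]; rewrite !inE /ends /= !xpair_eqE unfold_in /=.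
apply/idP/idP.
  case/andP=> hcd /eqP E.
  have ncd : c != d by apply: contraTneq hcd => ->; rewrite adj_irrefl.
  have : c \in [set a; b] by rewrite -E !inE eqxx.
  have : d \in [set a; b] by rewrite -E !inE eqxx orbT.
  rewrite !inE => /orP[]/eqP dE /orP[]/eqP cE; move: ncd;
    by rewrite dE cE !eqxx ?orbT.
by case/orP=> /andP[/eqP-> /eqP->]; rewrite ?hab ?eqxx // adj_sym hab setUC eqxx.
Qed.

End Arcs.

(** * Lower bound by growing a vertex set *)

Section LowerBound.
Variable G : sgraph.
Hypothesis tri : forall u v : G, adj u v -> 2 <= multiplicity u v.
Implicit Types (u v w x y : G) (S W : {set G}).

(** Let c be the number of common neighbours of [v] and [w] in [S]. Then [w] has at least 1 + c
    neighbours in [S], counting [v], and at least 2 - c in [W]. Arcs between [W] and [S] count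
    twice, so [w] contributes at least 2(1 + c) + (2 - c) = 4 + c. *)
Lemma arcs_add_neighbors S v (W := neighbors v :\: S) : v \in S ->
  arcs S S + 4 * #|W| + \sum_(w in W) #|neighbors w :&: (neighbors v :&: S)|
    <= arcs (S :|: W) (S :|: W).
Proof.
move=> vS.
have dSW : [disjoint S & W].
  by rewrite -setI_eq0; apply/eqP/setP=> x; rewrite !inE; case: (x \in S).
rewrite arcs_setU // -[leqLHS]addnA -[leqRHS]addnA leq_add2l.
rewrite mulnC -sum_nat_const /arcs big_distrr /=.
rewrite -!big_split; apply: leq_sum => w; rewrite !inE => /andP[wS vw] /=.
rewrite !sum_adj_card.
have := tri vw; rewrite /multiplicity.
rewrite -(cardsID S (neighbors v :&: neighbors w)).
rewrite (_ : _ :&: S = neighbors w :&: (neighbors v :&: S)); last first.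
  by rewrite setIAC setIC.
rewrite (_ : _ :\: S = neighbors w :&: W); last first.
  by apply/setP=> x; rewrite !inE; do !case: (_ \in _) || case: (adj _ _).
have : #|v |: (neighbors w :&: (neighbors v :&: S))| <= #|neighbors w :&: S|.
  apply: subset_leq_card; apply/subsetP=> x; rewrite !inE.
  by case/orP=> [/eqP->|/and3P[-> _ ->//]]; rewrite adj_sym vw vS.
rewrite cardsU1 !inE adj_irrefl /= andbF /=; lia.
Qed.

(** In terms of the number e of edges inside [S], [full] is e >= 2|S| - 2 and [overfull] is e >=
    2|S| - 1, doubled and free of subtraction. *)
Definition full S := 4 * #|S| <= arcs S S + 4.
Definition overfull S := 4 * #|S| < arcs S S + 4.

Lemma card_add_neighbors S v :
  #|S :|: (neighbors v :\: S)| = #|S| + #|neighbors v :\: S|.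
Proof.
rewrite cardsU (_ : S :&: _ = set0) ?cards0 ?subn0 //.
by apply/setP=> x; rewrite !inE; case: (x \in S).
Qed.

Lemma full_add_neighbors S v :
  v \in S -> full S -> full (S :|: (neighbors v :\: S)).
Proof.
move=> /arcs_add_neighbors; rewrite /full card_add_neighbors; lia.
Qed.

Lemma overfull_add_neighbors S v :
  v \in S -> overfull S -> overfull (S :|: (neighbors v :\: S)).
Proof.
move=> /arcs_add_neighbors; rewrite /overfull card_add_neighbors; lia.
Qed.

Lemma proper_add_neighbors S v w :
  adj v w -> w \notin S -> S \proper S :|: (neighbors v :\: S).
Proof.
move=> vw wS; rewrite properE subsetUl; apply/subsetPn; exists w => //.
by rewrite !inE vw wS orbT.
Qed.

(** The vertex [u] makes the term of [w] positive in the surplus sum of [arcs_add_neighbors]. *)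
Lemma overfull_triangle S v u w : full S -> v \in S -> u \in S -> w \notin S ->
  adj v u -> adj v w -> adj u w -> overfull (S :|: (neighbors v :\: S)).
Proof.
move=> fS vS uS wS vu vw uw; move: fS (arcs_add_neighbors vS).
rewrite (bigD1 w) ?inE ?wS //= /overfull /full card_add_neighbors.
have : 0 < #|neighbors w :&: (neighbors v :&: S)|.
  by rewrite card_gt0; apply/set0Pn; exists u; rewrite !inE adj_sym uw vu uS.
lia.
Qed.

(** Take a common neighbour [a] of [s] and [w]. If [a] is in [S], the triangle on [s], [a], [w]
    gives the surplus. Otherwise adding [w] alone gains its two edges to [s] and [t], so fullness
    persists, and then [a] forms a triangle with the inner edge between [s] and [w]. *)
Lemma overfull_two_neighbors S s t w : full S -> s \in S -> t \in S -> s != t ->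
  w \notin S -> adj s w -> adj t w ->
  exists2 S' : {set G}, S \proper S' & overfull S'.
Proof.
move=> fS sS tS nst wS sw tw.
have /card_gt0P[a] : 0 < multiplicity s w by apply: leq_trans (tri sw).
rewrite !inE => /andP[sa wa].
have [aS|aS] := boolP (a \in S).
  exists (S :|: (neighbors s :\: S)); first exact: proper_add_neighbors sw wS.
  by apply: (overfull_triangle fS sS aS wS) => //; rewrite adj_sym.
have fSw : full (w |: S).
  have dSw : [disjoint S & [set w]] by rewrite disjoint_sym disjoints1.
  rewrite /full setUC arcs_setU // cardsU.
  rewrite (_ : S :&: [set w] = set0); last by apply/eqP; rewrite setI_eq0.
  rewrite cards0 cards1 {2}/arcs big_set1 sum_adj_card.
  have : #|[set s; t]| <= #|neighbors w :&: S|.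
    apply: subset_leq_card; apply/subsetP=> x; rewrite !inE.
    by case/orP=> /eqP->; rewrite ?sS ?tS adj_sym ?sw ?tw.
  move: fS; rewrite cards2 nst /full; lia.
have nwa : a \notin w |: S.
  by rewrite !inE negb_or aS andbT; apply: contraTneq wa => ->; rewrite adj_irrefl.
exists ((w |: S) :|: (neighbors w :\: (w |: S))).
  rewrite properE -setUA subsetU ?subsetUl ?orbT //=.
    by apply/subsetPn; exists w; rewrite ?inE ?eqxx.
apply: (@overfull_triangle _ _ s a) => //; rewrite ?inE ?eqxx ?sS ?orbT //.
by rewrite adj_sym.
Qed.

(** The growth invariant: the bound without surplus is tolerated only in the residue class 1 mod
    3. *)
Definition good S := overfull S \/ full S /\ #|S| %% 3 = 1.

Lemma good_add_K4 S v x y z : v \in S -> x \notin S -> y \notin S -> z \notin S ->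
  adj v x -> adj v y -> adj v z -> adj x y -> adj x z -> adj y z ->
  good S -> exists2 S' : {set G}, S \proper S' & good S'.
Proof.
move=> vS xS yS zS vx vy vz xy xz yz gS.
have neq (a b : G) : adj a b -> (a == b) = false.
  by move=> ab; apply/negP=> /eqP E; rewrite E adj_irrefl in ab.
pose W := [set x; y; z].
have cW : #|W| = 3.
  rewrite /W setUC cardsU1 cards2 !inE (neq _ _ xy) ![z == _]eq_sym.
  by rewrite (neq _ _ xz) (neq _ _ yz).
have dSW : [disjoint S & W].
  rewrite disjoint_sym disjoint_subset; apply/subsetP=> t; rewrite !inE.
  by case/orP=> [/orP[]|] /eqP->.
exists (S :|: W).
  rewrite properE subsetUl; apply/subsetPn; exists x => //.
  by rewrite !inE eqxx !orbT.
have cSW : #|S :|: W| = #|S| + 3.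
  by rewrite cardsU (_ : S :&: W = set0) ?cards0 ?subn0 ?cW //;
    apply/eqP; rewrite setI_eq0.
(* Each of the three new vertices contributes 4: twice its arc to [v], plus two arcs inside [W]. *)
have : 12 <= 2 * arcs W S + arcs W W.
  rewrite /arcs big_distrr -big_split /=.
  apply: (@leq_trans (\sum_(w in W) 4)); first by rewrite sum_nat_const cW.
  apply: leq_sum => w wW; rewrite !sum_adj_card.
  have : 0 < #|neighbors w :&: S|.
    rewrite card_gt0; apply/set0Pn; exists v; rewrite !inE vS andbT adj_sym.
    by move: wW; rewrite !inE => /orP[/orP[]|] /eqP->.
  have : #|W :\ w| <= #|neighbors w :&: W|.
    apply: subset_leq_card; apply/subsetP=> t; rewrite !inE.
    case/andP=> ntw tW; rewrite tW andbT; move: wW tW ntw; rewrite !inE.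
    by do 2![case/orP=> [/orP[]|] /eqP->]; rewrite ?eqxx // => _; rewrite // adj_sym.
  have := cardsD1 w W; rewrite wW cW; lia.
move: gS; rewrite /good /overfull /full arcs_setU // cSW; lia.
Qed.

(* If no vertex outside S has two neighbours in S, then a common neighbour t of
   w and x other than v either completes a K4 through v, or acquires two
   neighbours in S once all neighbours of v are added. *)
Lemma good_grow S v w : v \in S -> w \notin S -> adj v w -> good S ->
  exists2 S' : {set G}, S \proper S' & good S'.
Proof.
move=> vS wS vw gS.
have [oS|fS] : overfull S \/ full S by case: gS => [|[]]; [left | right].
  exists (S :|: (neighbors v :\: S)); first exact: proper_add_neighbors vw wS.
  by left; apply: overfull_add_neighbors.
have two s t u : s \in S -> t \in S -> s != t -> u \notin S -> adj s u ->
    adj t u -> exists2 S' : {set G}, S \proper S' & good S'.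
  move=> sS tS nst uS su tu.
  by have [S' ? ?] := overfull_two_neighbors fS sS tS nst uS su tu;
    exists S' => //; left.
have neq a b : adj a b -> a != b.
  by move=> ab; apply: contraTneq ab => ->; rewrite adj_irrefl.
have /card_gt0P[x] : 0 < multiplicity v w by apply: leq_trans (tri vw).
rewrite !inE => /andP[vx wx].
have [xS|xS] := boolP (x \in S).
  by apply: (two v x w) => //; [exact: neq | rewrite adj_sym].
have [t] : exists t, t \in (neighbors w :&: neighbors x) :\ v.
  apply/set0Pn; rewrite -card_gt0.
  have := tri wx; rewrite /multiplicity (cardsD1 v); case: (v \in _); lia.
rewrite !inE => /and3P[ntv wt xt].
have [tS|tS] := boolP (t \in S).
  by apply: (two v t w) => //; [rewrite eq_sym | rewrite adj_sym].
have [vt|nvt] := boolP (adj v t).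
  exact: (@good_add_K4 S v w x t).
have pS := proper_add_neighbors vw wS.
have [||||||S' pS' oS'] :=
  @overfull_two_neighbors (S :|: (neighbors v :\: S)) w x t (full_add_neighbors vS fS).
- by rewrite !inE wS vw orbT.
- by rewrite !inE xS vx orbT.
- exact: neq.
- by rewrite !inE negb_or tS (negPf nvt).
- by [].
- by [].
by exists S'; [exact: proper_trans pS' | left].
Qed.

Lemma good_setT : connected G -> G -> good [set: G].
Proof.
move=> cG r.
suff grow S : r \in S -> good S -> good [set: G].
  (* A single vertex is full with no edges, and its size is 1 mod 3. *)
  apply: (grow [set r]); rewrite ?inE //; right.
  by rewrite /full cards1 muln1 leq_addl.
have [m] := ubnP #|~: S|; elim: m S => // m IH S ltm rS gS.
have [E|/set0Pn[z]] := eqVneq (~: S) set0.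
  by rewrite -setC0 -E setCK.
rewrite inE => zS.
(* A path from [r] to a vertex outside [S] has a first edge leaving [S]. *)
have [v [w [vS wS vw]]] : exists v w, [/\ v \in S, w \notin S & adj v w].
  have /connectP[p] := cG r z; elim: p {cG IH} r rS => [|a p IHp] b bS /=.
    by move=> _ zb; rewrite zb bS in zS.
  case/andP=> ba pa ez; have [aS|aS] := boolP (a \in S); first exact: IHp pa ez.
  by exists b, a.
have [S' pS gS'] := good_grow vS wS vw gS.
apply: (IH S') => //; last exact: subsetP (proper_sub pS) _ rS.
rewrite -ltnS; apply: leq_trans ltm; rewrite ltnS; apply: proper_card.
by rewrite properC.
Qed.

End LowerBound.

(** * Gluing a clique along a smaller clique *)

Section GlueClique.
Variables (G : sgraph) (Q : {set G}) (k : nat).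
Hypothesis cliqueQ : {in Q &, forall x y, adj x y = (x != y)}.

(** The [k] new vertices are adjacent to each other and to all of [Q], so together with the clique
    [Q] they form a clique on |Q| + k vertices. *)
Definition glue_adj (x y : G + 'I_k) :=
  match x, y with
  | inl a, inl b => adj a b
  | inl a, inr _ => a \in Q
  | inr _, inl b => b \in Q
  | inr i, inr j => i != j
  end.

Lemma glue_adj_sym : symmetric glue_adj.
Proof. by move=> [a|i] [b|j] //=; [exact: adj_sym | rewrite eq_sym]. Qed.

Lemma glue_adj_irrefl : irreflexive glue_adj.
Proof. by move=> [a|i] /=; rewrite ?adj_irrefl ?eqxx. Qed.

Definition glue := SGraph glue_adj_sym glue_adj_irrefl.

Definition glued_clique : {set glue} :=
  [set x : G + 'I_k | if x is inl a then a \in Q else true].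

Lemma card_glue : #|glue| = #|G| + k.
Proof. by rewrite card_sum card_ord. Qed.

Lemma card_glued_clique : #|glued_clique| = #|Q| + k.
Proof.
rewrite -sum1_card big_sumType /= -[k in RHS]card_ord -!sum1_card.
by congr (_ + _); apply: eq_bigl => x; rewrite !inE.
Qed.

Lemma glued_cliqueP : {in glued_clique &, forall x y, adj x y = (x != y)}.
Proof.
by move=> [a|i] [b|j]; rewrite !inE // => aQ bQ; exact: cliqueQ.
Qed.

Lemma arcs_glue : arcs [set: glue] [set: glue] =
  arcs [set: G] [set: G] + 2 * k * #|Q| + k * k.-1.
Proof.
have sumT (T : finType) (F : T -> nat) : \sum_(x in [set: T]) F x = \sum_x F x.
  by apply: eq_bigl => x; rewrite inE.
rewrite /arcs !sumT big_sumType /=.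
under eq_bigr do rewrite sumT big_sumType /= sum_nat_const card_ord.
under [X in _ + X]eq_bigr do rewrite sumT big_sumType /=.
under [in RHS]eq_bigr do rewrite sumT.
have cQ : \sum_(a : G) (a \in Q : nat) = #|Q|.
  by rewrite -sum1_card [RHS]big_mkcond; apply: eq_bigr => a _; case: (a \in Q).
have cK (i : 'I_k) : \sum_(j < k) (i != j : nat) = k.-1.
  rewrite -[k in RHS]card_ord -(cardC1 i) -sum1_card [RHS]big_mkcond.
  by apply: eq_bigr => j _; rewrite !inE eq_sym; case: (_ == _).
rewrite !big_split /= -big_distrr /= cQ sum_nat_const card_ord.
under [X in _ + (_ + X)]eq_bigr do rewrite cK.
rewrite sum_nat_const card_ord; lia.
Qed.

Lemma connected_glue : Q != set0 -> connected G -> connected glue.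
Proof.
case/set0Pn=> q qQ cG.
have cinl a b : connect (@adj glue) (inl a) (inl b).
  have /connectP[p pa ->] := cG a b.
  elim: p a pa => [|c p IH] a /=; first by rewrite connect0.
  by case/andP=> ac pc; apply: connect_trans (IH _ pc); apply: connect1.
have toq (x : glue) : connect (@adj glue) x (inl q).
  by case: x => [a|i]; [exact: cinl | apply: connect1].
have csym : connect_sym (@adj glue) by apply: sym_connect_sym; exact: adj_sym.
by move=> x y; apply: connect_trans (toq x) _; rewrite csym.
Qed.

Hypothesis card4 : #|Q| + k = 4.

(** An edge with both ends in the glued K4 has the other two vertices of that K4 as common
    neighbours; any other edge lies in [G] and keeps its common neighbours there. *)
Lemma glue_tri : (forall u v : G, adj u v -> 2 <= multiplicity u v) ->
  forall x y : glue, adj x y -> 2 <= multiplicity x y.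
Proof.
move=> tri x y xy.
have inK : x \in glued_clique -> y \in glued_clique -> 2 <= multiplicity x y.
  move=> xK yK; have nxy : x != y by rewrite -glued_cliqueP.
  have sK : glued_clique :\: [set x; y] \subset neighbors x :&: neighbors y.
    apply/subsetP=> z; rewrite in_setD in_set2 negb_or => /andP[/andP[zx zy] zK].
    by rewrite in_setI !in_set !glued_cliqueP // ![_ == z]eq_sym zx.
  apply: leq_trans (subset_leq_card sK); rewrite cardsD card_glued_clique card4.
  have := subset_leq_card (subsetIr glued_clique [set x; y]).
  rewrite cards2 nxy; lia.
move: x y xy inK => [a|i] [b|j] //= xy inK; try by apply: inK; rewrite inE.
have /card_gt1P[c [d [cI dI ncd]]] := tri _ _ xy.
apply/card_gt1P; exists (inl c), (inl d).
by split; rewrite // in_setI !in_set /=; move: cI dI; rewrite !inE.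
Qed.

(** All neighbours of a new vertex lie in the glued K4, so an edge from it to [Q] has only two
    common neighbours, whereas 5-density requires three. *)
Lemma glue_not_dense5 : 0 < k -> Q != set0 -> ~ dense 5 glue.
Proof.
move=> k0 /set0Pn[q qQ] [_ d5]; pose i := Ordinal k0.
have /d5 : adj (inl q : glue) (inr i) by [].
apply/negP; rewrite -ltnNge /multiplicity.
have sK : neighbors (inl q : glue) :&: neighbors (inr i : glue)
    \subset glued_clique :\: [set inl q; inr i].
  apply/subsetP=> -[a|j]; rewrite in_setD in_set2 in_setI !in_set /=.
    by case/andP=> qa ->; rewrite andbT orbF; apply: contraTneq qa => -[->];
      rewrite adj_irrefl.
  by case/andP=> _ ij; rewrite andbT; apply: contraNneq ij => -[->].
apply: leq_ltn_trans (subset_leq_card sK) _.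
rewrite cardsD card_glued_clique card4 (setIidPr _) ?cards2 //.
by apply/subsetP=> x; rewrite in_set2 => /orP[]/eqP->; rewrite inE.
Qed.

End GlueClique.

(** * Graphs attaining the bound *)

Lemma connected_neighbors (G : sgraph) :
  connected G -> 1 < #|G| -> forall u : G, neighbors u != set0.
Proof.
move=> cG G1 u; have := G1; rewrite (cardD1 u) inE ltnS => /card_gt0P[v].
rewrite !inE andbT => nvu; have /connectP[[|w p] /=] := cG u v.
  by move=> _ vu; rewrite vu eqxx in nvu.
by case/andP=> uw _ _; apply/set0Pn; exists w; rewrite inE.
Qed.

Lemma glue_admissible (G : sgraph) (Q : {set G}) k :
    {in Q &, forall x y, adj x y = (x != y)} -> #|Q| + k = 4 -> 0 < k < 4 ->
    connected G -> (forall u v : G, adj u v -> 2 <= multiplicity u v) ->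
  exists2 H : sgraph, admissible 4 (#|G| + k) H
    & 2 * #|edges H| = arcs [set: G] [set: G] + 2 * k * #|Q| + k * k.-1.
Proof.
move=> cliqueQ card4 /andP[k0 k4] cG tri.
have Q0 : Q != set0 by rewrite -card_gt0; lia.
have G0 : 0 < #|G| by case/set0Pn: Q0 => q _; apply/card_gt0P; exists q.
have cH := connected_glue (k := k) Q0 cG.
exists (glue Q k); last by rewrite -card_arcs arcs_glue.
split; [exact: card_glue | exact: cH | split; first split].
- by apply: connected_neighbors => //; rewrite card_glue; lia.
- exact: glue_tri.
- exact: glue_not_dense5.
Qed.

Lemma clique_sub (G : sgraph) (K : {set G}) s : s <= #|K| ->
    {in K &, forall x y, adj x y = (x != y)} ->
  exists2 Q : {set G}, #|Q| = s & {in Q &, forall x y, adj x y = (x != y)}.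
Proof.
case/card_geqP=> t [ut <- tK] cliqueK; exists [set x in t].
  by rewrite cardsE; exact/card_uniqP.
by move=> x y; rewrite !inE => /tK xK /tK yK; exact: cliqueK.
Qed.

(** Each K4 glued at one vertex of the previous one adds 3 vertices and 12 arcs. The start is a
    single vertex, which is isolated; hence only multiplicities are asserted, not [dense 4]. The
    clique [K] is kept as the place for the next gluing, possibly along an edge or a triangle. *)
Lemma windmill q : exists G : sgraph,
  [/\ #|G| = 3 * q + 1, connected G,
      forall u v : G, adj u v -> 2 <= multiplicity u v,
      arcs [set: G] [set: G] = 12 * q
    & exists2 K : {set G}, (if q is 0 then 1 else 4) <= #|K|
        & {in K &, forall x y, adj x y = (x != y)}].
Proof.
elim: q => [|q [G [cardG cG tri arcsG [K cardK cliqueK]]]].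
  pose G := @SGraph unit (fun _ _ => false) (fun _ _ => erefl) (fun _ => erefl).
  exists G; split => //; first by rewrite card_unit.
  - by move=> [] [].
  - by rewrite /arcs big1 // => x _; rewrite big1.
  - by exists setT => [|[] []]; rewrite ?cardsT ?card_unit.
have [||Q cardQ cliqueQ] := @clique_sub G K 1 => //.
  by apply: leq_trans cardK; case: (q).
have card4 : #|Q| + 3 = 4 by rewrite cardQ.
exists (glue Q 3); split.
- by rewrite card_glue cardG; lia.
- by apply: connected_glue => //; rewrite -card_gt0 cardQ.
- exact: glue_tri.
- by rewrite arcs_glue arcsG cardQ; lia.
- by exists (glued_clique Q 3); [rewrite card_glued_clique card4 | exact: glued_cliqueP].
Qed.

Theorem theorem4p4 (n : nat) (hn : 4 <= n) :
  is_e 4 n (if n == 1 %[mod 3] then 2 * n - 2 else 2 * n - 1).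
Proof.
have lower G : admissible 4 n G ->
    (if n == 1 %[mod 3] then 2 * n - 2 else 2 * n - 1) <= #|edges G|.
  case=> cardG cG [[_ tri] _].
  have /card_gt0P[r _] : 0 < #|G| by rewrite cardG; lia.
  have := good_setT tri cG r.
  rewrite /good /overfull /full card_arcs cardsT cardG; case: eqP; lia.
split=> //.
have upper : exists2 G, admissible 4 n G &
    #|edges G| <= (if n == 1 %[mod 3] then 2 * n - 2 else 2 * n - 1).
  (* The last K4 brings [k] new vertices, with [k] in 1..3 congruent to n - 1 mod 3, and is glued
     along a clique of size 4 - k. *)
  pose k := ((n - 2) %% 3).+1; pose q := (n - k) %/ 3.
  have nE : n = 3 * q + 1 + k by lia.
  have [G [cardG cG tri arcsG [K cardK cliqueK]]] := windmill q.
  have sK : 4 - k <= #|K|.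
    (* When [q] is 0, [n] at least 4 forces [k] to be 3, so the single vertex is a large enough
       clique. *)
    by apply: leq_trans cardK; move: nE; case: (q) => [|?]; lia.
  have [Q cardQ cliqueQ] := clique_sub sK cliqueK.
  have [||H aH eH] := @glue_admissible G Q k cliqueQ _ _ cG tri; try lia.
  exists H; first by rewrite nE -cardG.
  move: eH; rewrite arcsG cardQ.
  (* The edge counts are 6q + 3, 6q + 5 and 6q + 6 respectively; only [k] equal to 3 corresponds to
     n = 1 mod 3. *)
  have : k = 1 \/ k = 2 \/ k = 3 by lia.
  by move: k q nE {sK arcsG cardG cardK cardQ aH} => k q nE [|[|]] kE;
    rewrite kE in nE *; case: eqP; lia.
by case: upper => G aG leG; exists G => //; apply/eqP; rewrite eqn_leq leG lower.
Qed.
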